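(* A robber of speed $2$ can evade capture from $\Omega(n^{0.03})$ cops on the grid $[n]^2$ for $n$ sufficiently large; that is, there exist a constant $c>0$ and an integer $n_0$ such that for every $n\ge n_0$ and every number $m\le c\,n^{0.03}$ of cops, the robber has a strategy to evade capture forever by $m$ cops in the game Catching a Fast Robber, with robber speed $2$, on the grid $[n]^2$.
   Context: The grid $[n]^2$ is the graph with vertex set $\{1,\dots,n\}^2$ in which two distinct vertices are adjacent if and only if each coordinate differs by at most $1$ (so graph distance is the $l_\infty$ distance). Catching a Fast Robber, with robber speed $2$, is the following perfect information game on $[n]^2$. The cops choose their starting vertices (several cops may share a vertex), and then the robber chooses his starting vertex. The two sides then move alternately, the cops going first: on the cops' turn each cop moves to an adjacent vertex or stays put, and on the robber's turn he moves to any vertex at distance at most $2$ from his current vertex (possibly staying put). The robber loses (is caught) if at some point a cop is on the same vertex as him; he wins if he evades the cops forever. *)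

(* Defs.v *)
From mathcomp Require Import all_boot all_algebra.

Set Implicit Arguments.
Unset Strict Implicit.
Unset Printing Implicit Defensive.

Import IntDist.

(* {1,...,n}^2 with coordinates shifted to {0,...,n-1}. *)
Definition grid (n : nat) : finType := ('I_n * 'I_n)%type.

Definition grid_adj (n : nat) : rel (grid n) :=
  fun u v => [&& u != v, `|(u.1 : nat) - v.1|%N <= 1
                       & `|(u.2 : nat) - v.2|%N <= 1].

Section Game.

Variables (V : finType) (e : rel V) (s m : nat).

(* Graph distance at most k: a walk with at most k edges from u to v. *)
Definition dist_le (k : nat) (u v : V) : Prop :=
  exists p : seq V, [/\ path e u p, last u p = v & size p <= k].

(* The cops are labelled by 'I_m and may share vertices. *)
Definition cops : finType := {ffun 'I_m -> V}.

Definition cop_move (C C' : cops) : Prop :=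
  forall i, C' i = C i \/ e (C i) (C' i).

Definition caught (C : cops) (r : V) : Prop := exists i, C i = r.

(* A robber strategy receives the list [:: C_0; ...; C_t] of all cop
   configurations so far and answers with the position r_t taken after seeing
   C_t (r_0 is the start).  The earlier r_0, ..., r_(t-1) are determined by the
   strategy and by prefixes of that list, so they need not be arguments. *)
Definition robber_strategy := seq cops -> V.

Definition robber_pos (sigma : robber_strategy) (C : nat -> cops) (t : nat) : V :=
  sigma (mkseq C t.+1).

(* Order of play: C_0, r_0, C_1, r_1, ...; capture is tested after each
   placement or move of either side. *)
Definition robber_evades : Prop :=
  exists sigma : robber_strategy,
  forall C : nat -> cops, (forall t, cop_move (C t) (C t.+1)) ->
  forall t : nat,
    let r := robber_pos sigma C in
    [/\ dist_le s (r t) (r t.+1),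
        ~ caught (C t) (r t)
      & ~ caught (C t.+1) (r t)].

End Game.

(* Main.v *)
Require Import Defs.
From mathcomp Require Import all_boot all_order all_algebra.
From mathcomp Require Import reals exp.
From mathcomp Require Import boolp.
From mathcomp Require Import zify.

Set Implicit Arguments.
Unset Strict Implicit.
Unset Printing Implicit Defensive.

Import Order.TTheory GRing.Theory Num.Theory.
Local Open Scope ring_scope.

(** The robber makes only diagonal steps of length 2, and over a long stretch
of time he chooses between just two of them: (2, 2) and (2, -2) in the
coordinates [fwd], [lat] of a suitable frame.  Both raise [fwd] by 2, while a
cop changes it by at most 1, so a cop that has been overtaken stays behind.  A
cop can disturb a straight run in direction (2, 2) only from a cone around that
direction, and the cones of the two directions meet only near the robber
([threats_meet_near]).  So when the cops are too many for one direction, few of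
them are left to guard the other.

This is used recursively on scales.  Scale [l] has a length [width l] = 4096^l,
runs of 32 * [width l] steps and a [capacity l] of order (4/3)^l.  The claim
[crossing l] says that a robber who is not crowded at any smaller scale
([safe l]) and whose direction is threatened by at most [capacity l] cops can
complete a run in this direction, deviating a little, and is again not crowded
at its end.  A run at scale [l.+1] consists of 4096 runs at scale [l], each in
the wanted direction if possible and in the other one if not.

- One of the two is always possible although the capacity has grown by the
  factor 4/3, provided that at most half of the new capacity is near the robber
  ([two_way_choice]).  This proviso maintains itself: a cop that is near at the
  end of a run threatened at its start the direction taken, and only that one
  ([near_after_run]).
- The deviation does not add up over the scales.  A run in the wrong direction
  happens only when a fixed fraction of the capacity threatens, and a cop can
  threaten in at most four runs, because each run brings it so much closer to
  being overtaken ([visits_drop]).  Hence the deviation amounts to at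
  most 20 runs of the lower scale, out of 4096, whatever happens below.

With [capacity l.+1] cops altogether, one of the two directions is possible at
the beginning of every run of scale [l], so the robber can always choose a pair
of directions that lead back to the centre of the board and run forever
([roaming_run]).  A board of side 512 * 8192^l has room for this and for a
starting point away from all cops, and 8192^0.03 < 4/3. *)

(** * Frames *)

Definition point : Type := (int * int)%type.

(** Graph distance at most [k] on the grid, in integer coordinates. *)
Definition within (k : nat) (u v : point) : bool :=
  (`|v.1 - u.1| <= k%:Z) && (`|v.2 - u.2| <= k%:Z).

(** A symmetry of the square.  In its coordinates [fwd] and [lat] the robber's
main direction is (2, 2), and [flip] replaces it by (2, -2); every pair of
neighbouring diagonal directions arises in this way. *)
Record frame := Frame { swapped : bool; fwd_neg : bool; lat_neg : bool }.

Definition fwd (f : frame) (z : point) : int :=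
  let c := if swapped f then z.2 else z.1 in if fwd_neg f then - c else c.

Definition lat (f : frame) (z : point) : int :=
  let c := if swapped f then z.1 else z.2 in if lat_neg f then - c else c.

Definition flip (f : frame) : frame :=
  Frame (swapped f) (fwd_neg f) (~~ lat_neg f).

Lemma fwd_flip f z : fwd (flip f) z = fwd f z.
Proof. by []. Qed.

Lemma lat_flip f z : lat (flip f) z = - lat f z.
Proof. by case: f => -[] l [] /=; rewrite /lat /= ?opprK. Qed.

Lemma flipK f : flip (flip f) = f.
Proof. by case: f => s l u; rewrite /flip /= negbK. Qed.

Lemma frame_point f (a b : int) : exists z, fwd f z = a /\ lat f z = b.
Proof.
case: f => s l u; pose c := if l then - a else a.
pose d := if u then - b else b.
exists (if s then (d, c) else (c, d)).
by rewrite {}/c {}/d /fwd /lat; case: s; case: l; case: u; rewrite /= ?opprK.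
Qed.

Lemma within_frame f k u v : within k u v =
  (`|fwd f v - fwd f u| <= k%:Z) && (`|lat f v - lat f u| <= k%:Z).
Proof.
by rewrite /within /fwd /lat; case: f => -[] [] [] /=; apply/idP/idP; lia.
Qed.

Lemma within_refl k u : within k u u.
Proof. by rewrite /within !subrr normr0. Qed.

Lemma within_trans k j u v w :
  within k u v -> within j v w -> within (k + j)%N u w.
Proof. move=> /andP [h1 h2] /andP [h3 h4]. apply/andP; split; lia. Qed.

Lemma within_sym k u v : within k u v = within k v u.
Proof. by rewrite /within; apply/idP/idP; lia. Qed.

(** Seen from [u], the point [v] lies opposite to the forward axis, within 45
degrees, so both directions of the frame lead back towards [u]. *)
Lemma exists_homing_frame u v :
  exists f, fwd f v - fwd f u <= - `|lat f v - lat f u|.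
Proof.
pose b := `|v.1 - u.1| < `|v.2 - u.2|.
exists (Frame b (0 < if b then v.2 - u.2 else v.1 - u.1) false).
rewrite /b /fwd /lat /=; case: (ltrP `|v.1 - u.1| `|v.2 - u.2|) => h1;
  case: ifP; lia.
Qed.

(** Bounding the sum of the coordinates, not their maximum, is what fits
diagonal runs: the sides of the diamond are parallel to them. *)
Definition diamond (k : nat) (u v : point) : bool :=
  `|v.1 - u.1| + `|v.2 - u.2| <= k%:Z.

Lemma diamond_frame f k u v : diamond k u v =
  (`|fwd f v - fwd f u| + `|lat f v - lat f u| <= k%:Z).
Proof.
by rewrite /diamond /fwd /lat; case: f => -[] [] [] /=; apply/idP/idP; lia.
Qed.

(** * Forcing in a bounded number of steps *)

(** With distance at least 2 from every cop, the robber survives the next move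
of the cops too. *)
Definition clear {I : finType} (board : point -> bool)
    (C : I -> point) (r : point) : Prop :=
  board r /\ forall i, ~~ within 1 r (C i).

(** The robber can force [Q] in exactly [k] rounds, staying clear until then.
He commits to his next position before he sees the cops' next move; this only
makes him weaker. *)
Fixpoint reach {I : finType} (board : point -> bool) (k : nat)
    (Q : (I -> point) -> point -> Prop) (C : I -> point) (r : point) : Prop :=
  if k is j.+1 then
    clear board C r /\ exists r', within 2 r r' /\
      forall C', (forall i, within 1 (C i) (C' i)) -> reach board j Q C' r'
  else Q C r.

Lemma reach_mono {I : finType} board k
    (Q Q' : (I -> point) -> point -> Prop) C r :
  (forall C r, Q C r -> Q' C r) -> reach board k Q C r -> reach board k Q' C r.
Proof.
move=> QQ'; elim: k C r => [|k IH] C r /=; first exact: QQ'.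
move=> [g [r' [rr' H]]]; split=> //; exists r'; split=> // C' CC'.
exact/IH/H.
Qed.

Lemma reach_moved {I : finType} board k
    (Q : (I -> point) -> point -> Prop) C r :
  reach board k Q C r ->
  reach board k (fun C' r' => Q C' r' /\ forall i, within k (C i) (C' i)) C r.
Proof.
elim: k C r => [|k IH] C r /=.
  by move=> q; split=> // i; rewrite /within; lia.
move=> [g [r' [rr' H]]]; split=> //; exists r'; split=> // C' CC'.
move/IH: (H C' CC'); apply: reach_mono => C1 r1 [q m]; split=> // i.
exact: within_trans (CC' i) (m i).
Qed.

Lemma reach_add {I : finType} board k j
    (Q : (I -> point) -> point -> Prop) C r :
  reach board k (reach board j Q) C r -> reach board (k + j)%N Q C r.
Proof.
elim: k C r => [|k IH] C r //= [g [r' [rr' H]]].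
by split=> //; exists r'; split=> // C' CC'; apply/IH/H.
Qed.

Lemma reach_iter {I : finType} board N k
    (J : nat -> (I -> point) -> point -> Prop) C r :
  (forall j C r, (j < N)%N -> J j C r -> reach board k (J j.+1) C r) ->
  J 0%N C r -> reach board (N * k)%N (J N) C r.
Proof.
move=> step J0; elim: N step => [|N IH] step //.
rewrite mulSnr; apply: reach_add.
apply: reach_mono (IH _) => [C' r'|j C' r' jN]; first exact: step.
by apply: step; rewrite ltnW.
Qed.

(** * Threats to a run *)

(** A cop at [c] threatens a run of 32 * [F] steps from [r] if for some time
[t] he can come close to the place where the robber is then, which is (2t, 2t)
ahead.  A cop moves by at most [t]; the tolerance used is t + t/4 + F.  The
constant part [F] allows for cops that are close at the start and for earlier
deviations, and the part t/4 makes up for the deviation during the run itself,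
so that the same definition can be applied afresh to every run. *)
Definition threat (f : frame) (F : nat) (r c : point) : bool :=
  [exists t : 'I_(32 * F)%N.+1,
    (4 * `|fwd f c - fwd f r - 2 * t%:Z| <= 5 * t%:Z + 4 * F%:Z) &&
    (4 * `|lat f c - lat f r - 2 * t%:Z| <= 5 * t%:Z + 4 * F%:Z)].

Lemma threatP f F r c :
  reflect (exists t : nat, [/\ (t <= 32 * F)%N,
     4 * `|fwd f c - fwd f r - 2 * t%:Z| <= 5 * t%:Z + 4 * F%:Z &
     4 * `|lat f c - lat f r - 2 * t%:Z| <= 5 * t%:Z + 4 * F%:Z])
   (threat f F r c).
Proof.
apply: (iffP existsP) => [[t /andP [h1 h2]]|[t [tF h1 h2]]].
  by exists t; split=> //; rewrite -ltnS.
by exists (Ordinal (tF : (t < (32 * F)%N.+1)%N)); rewrite /= h1 h2.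
Qed.

Definition threats {I : finType} f F (C : I -> point) r : {set I} :=
  [set i | threat f F r (C i)].

Definition near {I : finType} F (C : I -> point) r : {set I} :=
  [set i | within (6 * F)%N r (C i)].

(** The direction (2, 2) can be threatened only from lat >= 3t/4 - F, and
(2, -2) only from lat <= F - 3s/4.  So t + s <= 8F/3, the smaller of the two
times is at most 4F/3, and then fwd is at most 13/4 times that plus F. *)
Lemma threats_meet_near {I : finType} f F (C : I -> point) r :
  threats f F C r :&: threats (flip f) F C r \subset near F C r.
Proof.
apply/subsetP => i; rewrite !inE (within_frame f).
move=> /andP [/threatP [t [tF h1 h2]] /threatP [s [sF]]].
rewrite !fwd_flip !lat_flip; lia.
Qed.

(** A cop that is near after the run was within 32F + 6F + 4d of the point
(64F, 64F) ahead before it; this is inside the tolerance at time t = 32F, and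
its [lat] is too large for the other direction. *)
Lemma near_after_run {I : finType} f F (C C' : I -> point) r r' (d : nat) :
  (4 * d <= F)%N -> (forall i, within (32 * F)%N (C i) (C' i)) ->
  fwd f r' = fwd f r + (64 * F)%N%:Z ->
  lat f r' = lat f r + (64 * F)%N%:Z - (4 * d)%N%:Z ->
  (0 < F)%N ->
  near F C' r' \subset threats f F C r :\: threats (flip f) F C r.
Proof.
move=> dF CC' lr mr F0; apply/subsetP => i; rewrite !inE (within_frame f) => h.
move: (CC' i); rewrite (within_frame f) => h'.
apply/andP; split; last first.
  apply/threatP; exists (32 * F)%N; split=> //; lia.
apply/negP => /threatP [t [tF]]; rewrite !fwd_flip !lat_flip; lia.
Qed.

(** [A] and [B] are the threats to the two directions, [m] the capacity of a
scale and [M] that of the next.  If [A] has too many elements, or too many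
outside [B], then few are left for [B]; both alternatives leave at most half of
[M] in the part that can be near at the end of the run.  The last bound says
that the second alternative occurs only when [A] has a fixed share of [M]. *)
Lemma two_way_choice {I : finType} (A B : {set I}) m :
  let M := (m + 1 + m %/ 3)%N in
  (#|A :&: B| <= M./2)%N -> (#|A :|: B| <= M)%N ->
  ((#|A| <= m)%N /\ (#|A :\: B| <= M./2)%N) \/
  [/\ (#|B| <= m)%N, (#|B :\: A| <= M./2)%N & (M < 5 * #|A|)%N].
Proof.
have := cardsID B A; have := cardsID A B; have := cardsUI A B.
rewrite (setIC B A).
move: #|A| #|B| #|A :&: B| #|A :|: B| #|A :\: B| #|B :\: A|.
move=> a b i u x y /= h1 h2 h3 h4 h5.
set M := (m + 1 + m %/ 3)%N in h4 h5 *.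
have M3 : (3 * M <= 4 * m + 3)%N by rewrite /M; lia.
have : (x <= M./2)%N && (a <= m)%N \/ (M./2 < x)%N || (m < a)%N by lia.
by case=> [/andP [-> ->]|h]; [left|right; split; lia].
Qed.

(** A long run replaces [F] by 4096F.  After time [s] and deviation [d] of it,
everything that threatens a short run in either direction has threatened the
long run from the start: the extra tolerance of the long run exceeds what the
deviation, including that of the short run, can contribute. *)
Lemma threats_sub {I : finType} f F (C C' : I -> point) r r' (s d : nat) :
  (s + 32 * F <= 32 * (4096 * F))%N -> (d <= 640 * F)%N ->
  (forall i, within s (C i) (C' i)) ->
  fwd f r' = fwd f r + (2 * s)%N%:Z ->
  lat f r' = lat f r + (2 * s)%N%:Z - (4 * d)%N%:Z ->
  threats f F C' r' :|: threats (flip f) F C' r'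
    \subset threats f (4096 * F)%N C r.
Proof.
move=> sF dF CC' lr mr; apply/subsetP => i; rewrite !inE.
move: (CC' i); rewrite (within_frame f) => h'.
case/orP => /threatP [t [tF]]; rewrite ?fwd_flip ?lat_flip => h1 h2;
  apply/threatP; exists (s + t)%N; split; lia.
Qed.

(** An upper bound for the number of future runs of 32F steps that a cop can
threaten.  A cop that threatens has [fwd] between -F and 127F relative to the
robber, and each run lowers this by at least 32F. *)
Definition visits F f (r c : point) : nat :=
  let x := fwd f c - fwd f r in
  ((- F%:Z <= x)%R + ((31 * F)%N%:Z <= x)%R
   + ((63 * F)%N%:Z <= x)%R + ((95 * F)%N%:Z <= x)%R)%N.

Lemma visits_drop {I : finType} f F (C C' : I -> point) r r' (A : {set I}) :
  (0 < F)%N -> (forall i, within (32 * F)%N (C i) (C' i)) ->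
  fwd f r' = fwd f r + (64 * F)%N%:Z ->
  threats f F C r :|: threats (flip f) F C r \subset A ->
  (#|threats f F C r :|: threats (flip f) F C r|
   + \sum_(i in A) visits F f r' (C' i) <= \sum_(i in A) visits F f r (C i))%N.
Proof.
set a := _ :|: _ => F0 CC' lr aA.
have -> : #|a| = (\sum_(i in A) (i \in a))%N.
  rewrite -sum1_card [RHS]big_mkcond [LHS]big_mkcond /=.
  apply: eq_bigr => i _; case: (boolP (i \in a)) => ia.
    by rewrite (subsetP aA).
  by case: ifP.
rewrite -big_split /=; apply: leq_sum => i _.
move: (CC' i); rewrite (within_frame f) /visits => h'.
have : i \in a -> - F%:Z <= fwd f (C i) - fwd f r < (127 * F)%N%:Z.
  by rewrite !inE => /orP[] /threatP [t [tF]]; rewrite ?fwd_flip ?lat_flip; lia.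
case: (i \in a) => [/(_ isT)|_]; lia.
Qed.

(** * The hierarchy of scales *)

Definition width (l : nat) : nat := (4096 ^ l)%N.

Lemma width_gt0 l : (0 < width l)%N.
Proof. by rewrite expn_gt0. Qed.

Lemma widthS l : width l.+1 = (4096 * width l)%N.
Proof. exact: expnS. Qed.

(** The growth, by about a third, that [two_way_choice] allows. *)
Fixpoint capacity (l : nat) : nat :=
  if l is k.+1 then (capacity k + 1 + capacity k %/ 3)%N else 0%N.

(** The deviation allowed in a run of scale [l]: twenty runs of scale [l] - 1. *)
Definition slip (l : nat) : nat :=
  if l is k.+1 then (640 * width k)%N else 0%N.

Lemma slip_le l : (6 * slip l <= width l)%N.
Proof. case: l => //= l; rewrite widthS; lia. Qed.

(** The robber is not crowded at any scale below [l].  Half of the next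
capacity is the proviso of [two_way_choice] for runs of scale [k]. *)
Definition safe {I : finType} l (C : I -> point) r : Prop :=
  forall k, (k < l)%N -> (#|near (width k) C r| <= (capacity k.+1)./2)%N.

Lemma safeS {I : finType} l (C : I -> point) r :
  safe l C r -> (#|near (width l) C r| <= (capacity l.+1)./2)%N ->
  safe l.+1 C r.
Proof.
move=> s n k; rewrite ltnS leq_eqVlt => /predU1P [->|] //; exact: s.
Qed.

(** A run of scale [l] in the main direction is possible.  The deviation [d]
counts steps made in the other direction.  Its bound is proportional to the
number of threatening cops because a cop threatens only a few of the short runs
within a long one: the sum of the bounds then does not depend on how many short
runs there are. *)
Definition crossing {I : finType} (board : point -> bool) l : Prop :=
  forall f (C : I -> point) r,
  (forall z, within (64 * width l)%N r z -> board z) -> safe l C r ->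
  (#|threats f (width l) C r| <= capacity l)%N ->
  reach board (32 * width l)%N (fun C' r' => exists d : nat,
    [/\ fwd f r' = fwd f r + (64 * width l)%N%:Z,
        lat f r' = lat f r + (64 * width l)%N%:Z - (4 * d)%N%:Z,
        (d * (capacity l).+1 <= slip l * #|threats f (width l) C r|)%N
      & safe l C' r']) C r.

Lemma slip_bound {I : finType} l (A : {set I}) d :
  (#|A| <= capacity l)%N -> (d * (capacity l).+1 <= slip l * #|A|)%N ->
  (d <= slip l)%N.
Proof.
move=> Al h; rewrite -(@leq_pmul2r (capacity l).+1) //; apply: leq_trans h _.
by rewrite leq_mul2l leqW ?orbT.
Qed.

(** One run of scale [l] against as many cops as scale [l.+1] can stand, in the
direction chosen by [two_way_choice].  A run in direction [flip f] counts as
a deviation by all its steps, except for those in which it deviates itself. *)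
Lemma run {I : finType} board l : crossing (I := I) board l ->
  forall f (C : I -> point) r,
  (forall z, within (64 * width l)%N r z -> board z) -> safe l.+1 C r ->
  (#|threats f (width l) C r :|: threats (flip f) (width l) C r|
    <= capacity l.+1)%N ->
  reach board (32 * width l)%N (fun C' r' =>
    (forall i, within (32 * width l)%N (C i) (C' i)) /\
    exists d : nat,
    [/\ fwd f r' = fwd f r + (64 * width l)%N%:Z,
        lat f r' = lat f r + (64 * width l)%N%:Z - (4 * d)%N%:Z,
        (d <= 32 * width l)%N,
        (d * (capacity l.+1).+1 <= 160 * width l *
          #|threats f (width l) C r :|: threats (flip f) (width l) C r|)%N
      & safe l.+1 C' r']) C r.
Proof.
move=> cross f C r rb sf tot.
set A := threats f _ C r in tot *; set B := threats (flip f) _ C r in tot *.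
have F0 := width_gt0 l; have sl := slip_le l.
have sfl : safe l C r by move=> k kl; apply: sf; rewrite ltnW.
have AB : (#|A :&: B| <= (capacity l.+1)./2)%N.
  by apply: leq_trans (sf l _) => //; apply/subset_leq_card/threats_meet_near.
have AU : (#|A| <= #|A :|: B|)%N by apply/subset_leq_card/subsetUl.
case: (two_way_choice AB tot) => [[Am Dh]|[Bm Dh A5]].
  apply: reach_mono (reach_moved (cross f C r rb sfl Am)).
  move=> C' r' [[d [lr mr db sf']] CC']; split=> //; exists d.
  have ds := slip_bound Am db.
  split=> //; first lia.
    (* Adding 1 to both capacities makes this hold for the empty scale too. *)
    have cS : ((capacity l.+1).+1 <= 2 * (capacity l).+1)%N by rewrite /=; lia.
    apply: leq_trans (leq_mul (leqnn d) cS) _.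
    rewrite mulnCA (leq_trans (leq_mul (leqnn 2) db)) // mulnA leq_mul //; lia.
  apply: safeS => //; apply: leq_trans Dh; apply: subset_leq_card.
  by apply: (@near_after_run _ _ _ _ _ _ _ d) => //; lia.
apply: reach_mono (reach_moved (cross (flip f) C r rb sfl Bm)).
move=> C' r' [[d [lr mr db sf']] CC']; split=> //; exists (32 * width l - d)%N.
have ds := slip_bound Bm db.
rewrite !fwd_flip !lat_flip in lr mr.
split=> //; [lia|lia| |].
  apply: leq_trans (leq_mul (leq_subr d _) A5) _.
  rewrite mulnA leq_mul //; lia.
apply: safeS => //; apply: leq_trans Dh; apply: subset_leq_card.
(* In the other direction the roles of the two sets of threats are exchanged. *)
have -> : A = threats (flip (flip f)) (width l) C r by rewrite flipK.
by apply: (@near_after_run _ _ _ _ _ _ _ d) => //;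
  rewrite ?fwd_flip ?lat_flip; lia.
Qed.

(** At scale 0 nobody threatens and the robber just walks: a cop next to him at
time [t] would have been a threat. *)
Lemma crossing0 {I : finType} board : crossing (I := I) board 0.
Proof.
move=> f C r rb _; rewrite leqn0 cards_eq0 => /eqP A0.
pose J (t : nat) (C' : I -> point) r' := [/\ forall i, within t (C i) (C' i),
  fwd f r' = fwd f r + (2 * t)%N%:Z & lat f r' = lat f r + (2 * t)%N%:Z].
suff H : reach board (32 * 1)%N (J 32%N) C r.
  apply: reach_mono H => C' r' [_ lr mr]; exists 0%N; split=> //.
  by rewrite mr subr0.
apply: reach_iter; last first.
  by split=> [i||]; rewrite ?within_refl ?muln0 ?addr0.
move=> t C' r' t32 [CC' lr mr] /=; split.
  split=> [|i]; first by apply: rb; rewrite (within_frame f) /width /=; lia.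
  apply/negP; rewrite (within_frame f) => h.
  have : i \in threats f (width 0) C r; last by rewrite A0 inE.
  move: (CC' i); rewrite (within_frame f) => h'.
  rewrite inE /width expn0; apply/threatP; exists t; split; lia.
have [r'' [lr' mr']] := frame_point f (fwd f r' + 2) (lat f r' + 2).
exists r''; split; first by rewrite (within_frame f) lr' mr'; lia.
move=> C'' C'C''; split; [|lia|lia] => i.
by rewrite -addn1; apply: within_trans (CC' i) (C'C'' i).
Qed.

(** Amortised analysis of 4096 short runs.  The invariant [J] adds the
deviation so far to a credit for every run that a cop may still threaten; a cop
starts with credit for four runs, and each short run is paid by those who
threaten it. *)
Lemma crossingS {I : finType} board l :
  crossing (I := I) board l -> crossing (I := I) board l.+1.
Proof.
move=> cross f C r rb sf Acap; set w := width l.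
set A := threats f _ C r in Acap *.
have w0 : (0 < w)%N := width_gt0 l.
have wS : width l.+1 = (4096 * w)%N := widthS l.
pose J (k : nat) (C' : I -> point) r' :=
  (forall i, within (k * (32 * w))%N (C i) (C' i)) /\ exists d : nat,
  [/\ fwd f r' = fwd f r + (2 * (k * (32 * w)))%N%:Z,
      lat f r' = lat f r + (2 * (k * (32 * w)))%N%:Z - (4 * d)%N%:Z,
      (d <= k * (32 * w))%N,
      (d * (capacity l.+1).+1 + 160 * w * \sum_(i in A) visits w f r' (C' i)
        <= 640 * w * #|A|)%N
    & safe l.+1 C' r'].
have -> : (32 * width l.+1 = 4096 * (32 * w))%N by rewrite wS; lia.
suff H : reach board (4096 * (32 * w))%N (J 4096%N) C r.
  apply: reach_mono H => C' r' [_ [d [lr mr _ dA sf']]]; exists d.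
  split=> //; [rewrite lr wS|rewrite mr wS|]; [lia|lia|].
  by apply: leq_trans dA; rewrite leq_addr.
apply: reach_iter; last first.
  split=> [i|]; first exact: within_refl.
  exists 0%N; split=> //; rewrite ?mul0n ?muln0 ?addr0 ?subr0 // add0n.
  rewrite (_ : 640 * w * #|A| = 160 * w * (#|A| * 4))%N; last lia.
  rewrite leq_mul // -sum_nat_const; apply: leq_sum => i _.
  by rewrite /visits; lia.
move=> k C' r' k4096 [CC' [d [lr mr dk dA sf']]].
move sE: (k * (32 * w))%N => s in CC' lr mr dk.
have sk : (s + 32 * w <= 32 * (4096 * w))%N by rewrite -sE; nia.
have ds : (d <= 640 * w)%N.
  apply: (@slip_bound I l.+1 A) => //=.
  by apply: leq_trans dA; rewrite leq_addr.
have aA : threats f w C' r' :|: threats (flip f) w C' r' \subset A.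
  by rewrite /A wS; apply: threats_sub mr.
have rb' z : within (64 * w)%N r' z -> board z.
  move=> r'z; apply: rb; move: r'z; rewrite !(within_frame f) wS; lia.
have tot := leq_trans (subset_leq_card aA) Acap.
apply: reach_mono (run cross rb' sf' tot) => C1 r1.
move=> [C'C1 [e [lr1 mr1 ew eA sf1]]].
rewrite /J mulSnr sE; split=> [i|]; first exact: within_trans (CC' i) (C'C1 i).
exists (d + e)%N; split=> //; [lia|lia|lia|].
(* The price of this run is covered by the credit that it uses up. *)
have := visits_drop w0 C'C1 lr1 aA.
move: dA eA; rewrite -/w; set V := \sum_(i in A) visits w f r' _.
set V' := \sum_(i in A) _; set a := #|_ :|: _|.
move=> dA eA /(leq_mul (leqnn (160 * w))); rewrite mulnDr mulnDl; lia.
Qed.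

Lemma crossingP {I : finType} board l : crossing (I := I) board l.
Proof. by elim: l => [|l IH]; [exact: crossing0|exact: crossingS]. Qed.

(** * Evading forever *)

(** The radius of the diamond is the displacement of a run, in the norm that
defines diamonds; a run in a homing frame cannot leave it. *)
Definition roaming {I : finType} (board : point -> bool) l
    (C : I -> point) (r : point) : Prop :=
  exists c, [/\ forall z, within (192 * width l)%N c z -> board z,
    diamond (128 * width l)%N c r & safe l.+1 C r].

Lemma roaming_run {I : finType} board l (C : I -> point) r :
  (#|I| <= capacity l.+1)%N -> roaming board l C r ->
  reach board (32 * width l)%N (roaming board l) C r.
Proof.
move=> Icap [c [cb cr sf]].
have [f Hf] := exists_homing_frame c r.
move: (cr); rewrite (diamond_frame f) => cr'.
have rb z : within (64 * width l)%N r z -> board z.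
  by move=> rz; apply: cb; move: rz; rewrite !(within_frame f); lia.
apply: reach_mono (run (f := f) (@crossingP I board l) rb sf _); last first.
  exact: leq_trans (max_card _) Icap.
move=> C' r' [_ [d [lr mr dw _ sf']]]; exists c; split=> //.
rewrite (diamond_frame f); lia.
Qed.

Lemma roaming_step {I : finType} board l (C : I -> point) r k :
  (#|I| <= capacity l.+1)%N -> reach board k (roaming board l) C r ->
  clear board C r /\ exists r', within 2 r r' /\
    forall C', (forall i, within 1 (C i) (C' i)) ->
    exists j, reach board j (roaming board l) C' r'.
Proof.
(* When no rounds are left, the next run begins. *)
move=> Icap; wlog k0 : k / (0 < k)%N => [IH|].
  case: k => [|k]; last exact: IH.
  by move/(roaming_run Icap)/IH; apply; rewrite muln_gt0 width_gt0.
case: k k0 => //= k _ [g [r' [rr' H]]]; split=> //.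
exists r'; split=> // C' CC'.
by exists k; apply: H.
Qed.

(** Among [#|I|.+1] points of a row that are 13 * [width l] apart, a cop is
near to at most one, so one of them has no cop near it at any scale. *)
Lemma exists_start {I : finType} l (C : I -> point) :
  exists x : nat, [/\ (192 * width l <= x)%N,
    (x <= 192 * width l + 13 * width l * #|I|)%N &
    safe l.+1 C (x%:Z, (192 * width l)%N%:Z)].
Proof.
set w := width l; have w0 : (0 < w)%N := width_gt0 l.
pose p (j : 'I_#|I|.+1) : point :=
  ((192 * w + 13 * w * j)%N%:Z, (192 * w)%N%:Z).
have [/forallP H|] :=
  boolP [forall j, exists i, within (6 * w)%N (p j) (C i)].
  pose g j := xchoose (existsP (H j)).
  have g_inj : injective g.
    move=> j j' E; apply: val_inj => /=.
    have := xchooseP (existsP (H j)); have := xchooseP (existsP (H j')).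
    rewrite -/(g j) -/(g j') -E /within /p /=.
    move: (C (g j)) (val j) (val j') => z a b h1 h2.
    have := leq_mul2l w a.+1 b; have := leq_mul2l w b.+1 a.
    rewrite !mulnS; case: (ltngtP a b) => // _; lia.
  by have := leq_card g g_inj; rewrite card_ord ltnn.
rewrite negb_forall => /existsP [j]; rewrite negb_exists => /forallP H.
exists (192 * w + 13 * w * j)%N; split; first exact: leq_addr.
  by rewrite leq_add2l leq_mul // -ltnS.
move=> k kl; rewrite (_ : near _ _ _ = set0) ?cards0 //.
apply/setP => i; rewrite !inE; apply: contraNF (H i).
have : (width k <= w)%N by rewrite leq_exp2l.
rewrite /within /p /=; move: (width k) => u; lia.
Qed.

(** A set of positions that the robber can stay in makes a strategy: he answers
with a choice function [f].  His position after C_0, ..., C_t is found by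
replaying C_0, ..., C_(t-1), as the answer does not use C_t. *)
Lemma evades_of_invariant (V : finType) (e : rel V) s m
    (W : cops V m -> V -> Prop) (v0 : V) :
  (forall C, exists r, W C r) ->
  (forall C r, W C r ->
    [/\ ~ caught C r, forall C', cop_move e C C' -> ~ caught C' r &
      exists r', dist_le e s r r' /\ forall C', cop_move e C C' -> W C' r']) ->
  robber_evades e s m.
Proof.
move=> /choice [init W0] Wstep.
have /choice [f Hf] : forall x : cops V m * V, exists r', W x.1 x.2 ->
    dist_le e s x.2 r' /\ forall C', cop_move e x.1 C' -> W C' r'.
  move=> [C r] /=; case: (pselect (W C r)) => [/Wstep [_ _ [r' H]]|nW].
    by exists r'.
  (* Positions outside W are never met; the answer there is arbitrary. *)
  by exists v0.
pose sigma (h : seq (cops V m)) :=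
  foldl (fun r C => f (C, r)) (if h is C0 :: _ then init C0 else v0)
    (take (size h).-1 h).
exists sigma => C mvC t /=.
have posE k : robber_pos sigma C k =
    foldl (fun r C => f (C, r)) (init (C 0%N)) (mkseq C k).
  rewrite /robber_pos /sigma size_mkseq /= [in take _ _]mkseqS -cats1.
  by rewrite take_size_cat ?size_mkseq.
have posS k : robber_pos sigma C k.+1 = f (C k, robber_pos sigma C k).
  by rewrite !posE mkseqS foldl_rcons.
have Wt k : W (C k) (robber_pos sigma C k).
  elim: k => [|k IH]; first by rewrite posE.
  by rewrite posS; apply: (Hf (C k, _) IH).2 (mvC k).
have [nc nc' _] := Wstep _ _ (Wt t).
split=> //; last exact: nc'.
by rewrite posS; apply: (Hf (C t, _) (Wt t)).1.
Qed.

(** * The game on the grid *)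

Definition coords {n : nat} (u : grid n) : point :=
  ((u.1 : nat)%:Z, (u.2 : nat)%:Z).

Definition board (n : nat) (z : point) : bool :=
  (0 <= z.1 < n%:Z) && (0 <= z.2 < n%:Z).

Lemma coords_onto n z : board n z -> exists u : grid n, coords u = z.
Proof.
case: z => [[x|x] [y|y]]; rewrite /board /=; try lia.
move=> h; have [xn yn] : (x < n)%N /\ (y < n)%N by lia.
by exists (Ordinal xn, Ordinal yn).
Qed.

(** [grid_adj] states the distance in terms of another copy of the additive
structure of the integers, so its definition has to be converted first. *)
Lemma grid_adjE n (u v : grid n) :
  grid_adj u v = (u != v) && within 1 (coords u) (coords v).
Proof.
have -> : grid_adj u v = [&& u != v,
    (absz ((u.1 : nat)%:Z - (v.1 : nat)%:Z) <= 1)%N &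
    (absz ((u.2 : nat)%:Z - (v.2 : nat)%:Z) <= 1)%N] by [].
by congr (_ && _); rewrite /within /=; apply/idP/idP; lia.
Qed.

Lemma grid_adj_within n (u v : grid n) :
  (v = u \/ grid_adj u v) <-> within 1 (coords u) (coords v).
Proof.
rewrite grid_adjE; split=> [[->|/andP[]] //|uv]; first exact: within_refl.
by case: (eqVneq u v) => [->|_]; [left|right].
Qed.

Lemma dist_le_within n (u v : grid n) :
  within 2 (coords u) (coords v) -> dist_le (@grid_adj n) 2 u v.
Proof.
move=> uv.
have [w [uw wv]] : exists w : grid n,
    within 1 (coords u) (coords w) /\ within 1 (coords w) (coords v).
  have l1 : ((u.1 + v.1)./2 < n)%N.
    by have := ltn_ord u.1; have := ltn_ord v.1; lia.
  have l2 : ((u.2 + v.2)./2 < n)%N.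
    by have := ltn_ord u.2; have := ltn_ord v.2; lia.
  exists (Ordinal l1, Ordinal l2); move: uv; rewrite /within /=; lia.
case/grid_adj_within: uw => [wu|uw]; case/grid_adj_within: wv => [vw|wv].
- by exists [::]; rewrite /= vw wu.
- by exists [:: v]; rewrite /= -wu wv.
- by exists [:: w]; rewrite /= uw vw.
- by exists [:: w; v]; rewrite /= uw wv.
Qed.

Lemma grid_evades n m l : (m <= capacity l.+1)%N ->
  (384 * width l + 13 * width l * m < n)%N -> robber_evades (@grid_adj n) 2 m.
Proof.
move=> mcap nbig; pose E (C : cops (grid n) m) i := coords (C i).
have Icap : (#|'I_m| <= capacity l.+1)%N by rewrite card_ord.
have n0 : (0 < n)%N by apply: leq_ltn_trans nbig.
apply: (@evades_of_invariant _ _ _ _ (fun C r =>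
  exists k, reach (board n) k (roaming (board n) l) (E C) (coords r))
  (Ordinal n0, Ordinal n0)) => [C|C r [k /(roaming_step Icap)]].
  have [x [lx xl sf]] := exists_start l (E C); rewrite card_ord in xl.
  have [r rE] : exists u : grid n, coords u = (x%:Z, (192 * width l)%N%:Z).
    by apply: coords_onto; rewrite /board /=; lia.
  exists r, 0%N, (coords r); rewrite rE; split=> //.
  - by move=> z; rewrite /within /board /=; lia.
  - by rewrite /diamond /=; lia.
move=> [[_ far] [r' [rr' H]]].
have mv C' : cop_move (@grid_adj n) C C' -> forall i, within 1 (E C i) (E C' i).
  by move=> CC' i; apply/grid_adj_within.
split.
- by move=> [i Ci]; case/negP: (far i); rewrite /E Ci within_refl.
- move=> C' /mv CC' [i Ci]; case/negP: (far i).
  by rewrite -Ci within_sym; apply: CC'.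
have {}H C' (CC' : cop_move (@grid_adj n) C C') := H _ (mv C' CC').
have [u uE] : exists u : grid n, coords u = r'.
  have [C' CC'] : exists C', cop_move (@grid_adj n) C C' by exists C => i; left.
  have [j /(roaming_step Icap) [[rb _] _]] := H C' CC'.
  exact: coords_onto.
by exists u; rewrite uE; split=> //; apply: dist_le_within; rewrite uE.
Qed.

(** * The exponent 0.03 *)

Lemma capacity_ub l : (capacity l < 2 ^ l)%N.
Proof. by elim: l => //= l IH; rewrite expnS; lia. Qed.

Lemma capacity_lb l : (4 ^ l <= 3 ^ l * (capacity l).+1)%N.
Proof.
elim: l => //= l IH; rewrite !expnS.
have h : (4 * (capacity l).+1
    <= 3 * (capacity l + 1 + capacity l %/ 3).+1)%N by lia.
apply: leq_trans (leq_mul (leqnn 4) IH) _.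
by rewrite mulnCA [leqRHS]mulnAC -[leqRHS]mulnC leq_mul.
Qed.

(** If m exceeds [capacity k] then m^100 >= (4/3)^(100 k) >= 2^(40 k), by
3^5 < 2^8, whereas n^3 < 2^(27 + 39 k). *)
Lemma capacity_of_power k m n : (0 < k)%N ->
  (n < 2 ^ (9 + 13 * k))%N -> ((2 * m) ^ 100 <= n ^ 3)%N -> (m <= capacity k)%N.
Proof.
move=> k0 nk mn; rewrite leqNgt; apply/negP => cm.
have m4 : (4 ^ k <= 3 ^ k * m)%N.
  by apply: leq_trans (capacity_lb k) _; rewrite leq_mul2l cm orbT.
have e3 : (3 ^ (100 * k) <= 2 ^ (160 * k))%N.
  have -> : (100 * k = 5 * (20 * k))%N by lia.
  have -> : (160 * k = 8 * (20 * k))%N by lia.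
  by rewrite !(expnM _ _ (20 * k)) leq_exp2r ?muln_gt0.
have e4 : (2 ^ (40 * k) <= m ^ 100)%N.
  rewrite -(@leq_pmul2l (2 ^ (160 * k))) ?expn_gt0 // -expnD.
  rewrite (_ : 160 * k + 40 * k = 2 * k * 100)%N; last lia.
  rewrite expnM (expnM 2 2); apply: leq_trans (leq_mul e3 (leqnn _)).
  by rewrite (mulnC 100%N) expnM -expnMn leq_exp2r.
have e5 : (2 ^ (100 + 40 * k) <= n ^ 3)%N.
  by apply: leq_trans mn; rewrite expnMn expnD leq_mul2l e4 orbT.
have : (n ^ 3 < (2 ^ (9 + 13 * k)) ^ 3)%N by rewrite ltn_exp2r.
rewrite -expnM => /(leq_ltn_trans e5); rewrite ltn_exp2l //; lia.
Qed.

Theorem corollary4p2 (R : realType) :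
  exists (c : R) (n0 : nat), 0 < c /\
    forall n : nat, (n0 <= n)%N ->
    forall m : nat, m%:R <= c * (n%:R : R) `^ (3%:R / 100%:R) ->
      robber_evades (@grid_adj n) 2 m.
Proof.
exists (2%:R^-1), (2 ^ 9)%N; split=> [|n n9 m mn]; first by rewrite invr_gt0.
have mn3 : ((2 * m) ^ 100 <= n ^ 3)%N.
  rewrite -(ler_nat R) !natrX.
  have -> : n%:R ^+ 3 = ((n%:R : R) `^ (3%:R / 100%:R)) ^+ 100.
    rewrite -[RHS]powR_mulrn ?powR_ge0 // -powRrM divfK ?pnatr_eq0 //.
    by rewrite powR_mulrn.
  by rewrite lerXn2r ?nnegrE ?powR_ge0 // natrM -ler_pdivlMl // mulrC.
(* The largest scale for which the board is big enough. *)
pose l := trunc_log (2 ^ 13) (n %/ 2 ^ 9).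
have n9' : (0 < n %/ 2 ^ 9)%N by rewrite divn_gt0 ?expn_gt0.
have p13 : (1 < 2 ^ 13)%N by rewrite (@ltn_exp2l 2 0).
have /andP [ln nl] := trunc_log_bounds p13 n9'.
rewrite -/l in ln nl.
have mcap : (m <= capacity l.+1)%N.
  apply: (@capacity_of_power l.+1 m n) => //.
  by move: nl; rewrite ltn_divLR ?expn_gt0 // -expnM -expnD addnC.
apply: (grid_evades mcap).
have m2 : (m < 2 * 2 ^ l)%N.
  by rewrite -expnS; apply: leq_ltn_trans (capacity_ub _).
move: ln; rewrite leq_divRL ?expn_gt0 // -expnM.
have -> : (2 ^ (13 * l) = width l * 2 ^ l)%N.
  by rewrite /width -[4096%N]/(2 ^ 12)%N -expnM -expnD; congr (_ ^ _)%N; lia.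
apply: leq_trans.
have := width_gt0 l; have : (0 < 2 ^ l)%N by rewrite expn_gt0.
move: (width l) (2 ^ l)%N m2 => w u m2 u0 w0.
have -> : (384 * w + 13 * w * m = w * (384 + 13 * m))%N by lia.
by rewrite -mulnA ltn_pmul2l // -[(2 ^ 9)%N]/512%N; lia.
Qed.
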